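(* Let $\ell\in\frac12\mathbb N$ and $d\in\mathbb N$. For the conformal Galilei algebra $\mathfrak g_\ell(d)$ without central extension, $$\operatorname{Der}\mathfrak g_\ell(d)=\operatorname{Inn}\mathfrak g_\ell(d)\oplus\mathbb C\delta_0 .$$
   Context: All algebras are over $\mathbb C$; $\mathbb N=\{1,2,\dots\}$. $\operatorname{Der}$ denotes the derivation algebra and $\operatorname{Inn}$ the inner derivations; $\oplus$ is a direct sum of vector spaces. The Lie algebra $\mathfrak g_\ell(d)$ has basis $D,H,C$, $M_{ij}$ ($1\le i<j\le d$, with $M_{ji}=-M_{ij}$), $P_i^{(n)}$ ($1\le i\le d$, $0\le n\le 2\ell$), and non-zero brackets (up to skew-symmetry) $$[D,H]=2H,\quad [D,C]=-2C,\quad [C,H]=D,$$ $$[M_{ij},M_{kl}]=-\delta_{ik}M_{jl}-\delta_{jl}M_{ik}+\delta_{il}M_{jk}+\delta_{jk}M_{il},$$ $$[H,P_i^{(n)}]=-nP_i^{(n-1)},\quad [D,P_i^{(n)}]=2(\ell-n)P_i^{(n)},\quad [C,P_i^{(n)}]=(2\ell-n)P_i^{(n+1)},$$ $$[M_{ij},P_k^{(n)}]=-\delta_{ik}P_j^{(n)}+\delta_{jk}P_i^{(n)},$$ with $P_i^{(-1)}=P_i^{(2\ell+1)}=0$. $\delta_0:\mathfrak g_\ell(d)\to\mathfrak g_\ell(d)$ is the linear map with $\delta_0(D)=\delta_0(H)=\delta_0(C)=\delta_0(M_{ij})=0$ and $\delta_0(P_i^{(n)})=P_i^{(n)}$. 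*)

(* Defs.v *)
From HB Require Import structures.
From mathcomp Require Import all_boot all_order all_algebra.
From mathcomp Require Import ring.

Set Implicit Arguments.
Unset Strict Implicit.
Unset Printing Implicit Defensive.

Import GRing.Theory Num.Theory.
Local Open Scope ring_scope.

HB.mixin Record Vector_isLieAlgebra (K : fieldType) V of Vector K V := {
  lie : V -> V -> V;
  lie_linear_l : forall y, linear (lie^~ y);
  lie_linear_r : forall x, linear (lie x);
  lie_alt : forall x, lie x x = 0;
  lie_jacobi : forall x y z,
    lie x (lie y z) + lie y (lie z x) + lie z (lie x y) = 0
}.

#[short(type="lieAlgType")]
HB.structure Definition LieAlgebra (K : fieldType) :=
  { V of Vector_isLieAlgebra K V & Vector K V }.

Section Derivations.
Variables (K : fieldType) (g : lieAlgType K).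
Implicit Types (x y : g) (f : 'End(g)).

HB.instance Definition _ x :=
  GRing.isLinear.Build K g g _ (lie x) (@lie_linear_r K g x).

Lemma liePl a x y z : lie (a *: x + y) z = a *: lie x z + lie y z.
Proof. exact: (lie_linear_l z). Qed.

Lemma liePr a x y z : lie x (a *: y + z) = a *: lie x y + lie x z.
Proof. exact: (lie_linear_r x). Qed.

Definition adj x : 'End(g) := linfun (lie x).

Lemma adjE x y : adj x y = lie x y.
Proof. by rewrite lfunE. Qed.

Lemma adj_linear : linear adj.
Proof.
move=> a x y; apply/lfunP => z.
by rewrite add_lfunE scale_lfunE !adjE liePl.
Qed.
HB.instance Definition _ := GRing.isLinear.Build K g 'End(g) _ adj adj_linear.

Definition Inn : {vspace 'End(g)} := limg (linfun adj).

Lemma InnP f : reflect (exists x, f = adj x) (f \in Inn).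
Proof.
apply: (iffP idP) => [/memv_imgP[x _ ->]|[x ->]].
  by exists x; rewrite lfunE.
by rewrite -[adj x](lfunE adj) memv_img ?memvf.
Qed.

Definition derivation f :=
  forall x y, f (lie x y) = lie (f x) y + lie x (f y).

Definition der_defect_at f x : 'End(g) :=
  (f \o adj x)%VF - adj (f x) - (adj x \o f)%VF.

Lemma der_defect_atE f x y :
  der_defect_at f x y = f (lie x y) - lie (f x) y - lie x (f y).
Proof. by rewrite !(add_lfunE, opp_lfunE, comp_lfunE, adjE). Qed.

Lemma der_defect_at_linear f : linear (der_defect_at f).
Proof.
move=> a x y; apply/lfunP => z; rewrite [RHS]add_lfunE [in RHS]scale_lfunE !der_defect_atE.
have fP u v : f (a *: u + v) = a *: f u + f v by exact: linearP.
rewrite !(liePl, fP) !scalerBr !opprD.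
by rewrite [X in X + _ = _]addrACA [LHS]addrACA.
Qed.
HB.instance Definition _ f :=
  GRing.isLinear.Build K g 'End(g) _ (der_defect_at f) (der_defect_at_linear f).

Definition der_defect f : 'Hom(g, 'End(g)) := linfun (der_defect_at f).

Lemma der_defectE f x y :
  der_defect f x y = f (lie x y) - lie (f x) y - lie x (f y).
Proof. by rewrite -der_defect_atE -(lfunE (der_defect_at f)). Qed.

Lemma der_defect_linear : linear der_defect.
Proof.
move=> a f h; apply/lfunP => x; apply/lfunP => y.
rewrite [in RHS]add_lfunE [in RHS]scale_lfunE [RHS]add_lfunE [in RHS]scale_lfunE.
rewrite !der_defectE !add_lfunE !scale_lfunE.
rewrite liePl liePr !scalerBr !opprD.
by rewrite [X in X + _ = _]addrACA [LHS]addrACA.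
Qed.
HB.instance Definition _ :=
  GRing.isLinear.Build K 'End(g) 'Hom(g, 'End(g)) _ der_defect der_defect_linear.

Definition Der : {vspace 'End(g)} := lker (linfun der_defect).

Lemma DerP f : derivation f <-> f \in Der.
Proof.
rewrite memv_ker lfunE /=; split=> [fD | /eqP f0 x y].
  apply/eqP/lfunP => x; apply/lfunP => y.
  by rewrite der_defectE fD !zero_lfunE -addrA -opprD subrr.
have := der_defectE f x y; rewrite f0 !zero_lfunE -addrA -opprD.
by move=> /esym/eqP; rewrite subr_eq0 => /eqP.
Qed.
End Derivations.

(* The Jacobi identity on basis elements, derived from the table of brackets
   alone; the coordinates co t reduce it to identities between scalars. *)
Section JacobiFromTable.
Variables (K : numFieldType) (twol : nat) (I : Type) (V : lmodType K).
Variables (T : Type) (co : T -> V -> K) (br : V -> V -> V).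
Variables (D H C : V) (M : I -> I -> V) (P : I -> nat -> V).
Variables (dl : I -> I -> K) (l : K).
Hypothesis coD : forall t x y, co t (x + y) = co t x + co t y.
Hypothesis co0 : forall t, co t 0 = 0.
Hypothesis coN : forall t x, co t (- x) = - co t x.
Hypothesis coZ : forall t c x, co t (c *: x) = c * co t x.
Hypothesis co_inj : forall x y, (forall t, co t x = co t y) -> x = y.
Hypothesis brC : forall x y, br x y = - br y x.
Hypothesis brD : forall x y z, br x (y + z) = br x y + br x z.
Hypothesis brN : forall x y, br x (- y) = - br x y.
Hypothesis brZ : forall x c y, br x (c *: y) = c *: br x y.
Hypothesis br0 : forall x, br x 0 = 0.
Hypothesis dlC : forall i j, dl i j = dl j i.
Hypothesis MN : forall i j, M i j = - M j i.
Hypothesis l2 : 2 * l = twol%:R.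
Hypothesis DD : br D D = 0.
Hypothesis HH : br H H = 0.
Hypothesis CC : br C C = 0.
Hypothesis DH : br D H = 2 *: H.
Hypothesis DC : br D C = - 2 *: C.
Hypothesis CH : br C H = D.
Hypothesis DM : forall i j, br D (M i j) = 0.
Hypothesis HM : forall i j, br H (M i j) = 0.
Hypothesis CM : forall i j, br C (M i j) = 0.
Hypothesis MM : forall i j k m, br (M i j) (M k m) =
  - dl i k *: M j m - dl j m *: M i k + dl i m *: M j k + dl j k *: M i m.
Hypothesis DP : forall i n, br D (P i n) = (2 * (l - n%:R)) *: P i n.
Hypothesis HP : forall i n, (n <= twol)%N -> br H (P i n) = - n%:R *: P i n.-1.
Hypothesis CP : forall i n, br C (P i n) = (2 * l - n%:R) *: P i n.+1.
Hypothesis MP : forall i j k n,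
  br (M i j) (P k n) = - dl i k *: P j n + dl j k *: P i n.
Hypothesis PP : forall i j m n, br (P i m) (P j n) = 0.

Let HD : br H D = - (2 *: H). Proof. by rewrite brC DH. Qed.
Let CD : br C D = - (- 2 *: C). Proof. by rewrite brC DC. Qed.
Let HC : br H C = - D. Proof. by rewrite brC CH. Qed.
Let MD i j : br (M i j) D = 0. Proof. by rewrite brC DM oppr0. Qed.
Let MH i j : br (M i j) H = 0. Proof. by rewrite brC HM oppr0. Qed.
Let MC i j : br (M i j) C = 0. Proof. by rewrite brC CM oppr0. Qed.
Let PD i n : br (P i n) D = - ((2 * (l - n%:R)) *: P i n).
Proof. by rewrite brC DP. Qed.
Let PH i n : (n <= twol)%N -> br (P i n) H = - (- n%:R *: P i n.-1).
Proof. by move=> nN; rewrite brC HP. Qed.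
Let PC i n : br (P i n) C = - ((2 * l - n%:R) *: P i n.+1).
Proof. by rewrite brC CP. Qed.
Let PM i j k n : br (P k n) (M i j) = - (- dl i k *: P j n + dl j k *: P i n).
Proof. by rewrite brC MP. Qed.

Let table := (DH, DC, CH, MM, DM, HM, CM, DP, CP, MP, PP, HD, CD, HC, MD, MH,
  MC, PD, PC, PM, DD, HH, CC, brD, brZ, brN, br0).

Definition jac x y z := br x (br y z) + br y (br z x) + br z (br x y).

Local Ltac scalars := by apply: co_inj => ?; rewrite !(coD, coN, coZ, co0); ring.

Lemma jac_MMM i j k m p q : jac (M i j) (M k m) (M p q) = 0.
Proof.
rewrite /jac !table.
rewrite (MN m j) (MN k j) (MN m i) (MN k i) (MN q m) (MN p m) (MN q k) (MN p k).
rewrite (MN q j) (MN p j) (MN q i) (MN p i).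
rewrite (dlC m j) (dlC k j) (dlC m i) (dlC k i) (dlC q m) (dlC p m) (dlC q k).
rewrite (dlC p k) (dlC q j) (dlC p j) (dlC q i) (dlC p i).
scalars.
Qed.

Lemma jac_MMP i j k m p n : jac (M i j) (M k m) (P p n) = 0.
Proof.
rewrite /jac !table (dlC m j) (dlC k j) (dlC m i) (dlC k i).
scalars.
Qed.

Lemma jac_HCP i n : (n <= twol)%N -> jac H C (P i n) = 0.
Proof.
move=> nN; have n'N : (n.-1 <= twol)%N by exact: leq_trans (leq_pred n) nN.
rewrite /jac PH // HC CP brN !brZ CP brN (brC (P i n) D) DP.
have -> : (2 * l - n%:R) *: br H (P i n.+1) = ((2 * l - n%:R) * - n.+1%:R) *: P i n.
  have [n_lt|n_ge] := ltnP n twol; first by rewrite HP // scalerA.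
  have -> : n = twol by apply/eqP; rewrite eqn_leq nN.
  by rewrite l2 subrr mul0r !scale0r.
by case: n {nN n'N} => [|n] /=; rewrite -?natr1; scalars.
Qed.

Lemma jac_DHP i n : (n <= twol)%N -> jac D H (P i n) = 0.
Proof.
move=> nN; have n'N : (n.-1 <= twol)%N by exact: leq_trans (leq_pred n) nN.
rewrite /jac PD HP // DH brN !brZ HP // PH // DP.
by case: n {nN n'N} => [|n] /=; rewrite -?natr1; scalars.
Qed.

Variant letter := LD | LH | LC | LM of I & I | LP of I & nat.
Definition wf_letter a := if a is LP _ n then (n <= twol)%N else true.
Definition vec a :=
  match a with LD => D | LH => H | LC => C | LM i j => M i j | LP i n => P i n end.
Definition rank a : nat :=
  match a with LD => 0 | LH => 1 | LC => 2 | LM _ _ => 3 | LP _ _ => 4 end.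

Lemma jac_sorted a b c : wf_letter a -> wf_letter b -> wf_letter c ->
  (rank a <= rank b <= rank c)%N -> jac (vec a) (vec b) (vec c) = 0.
Proof.
case: a b c => [|||i j|i a] [|||k m|k b] [|||p q|p c] //= aN bN cN _;
  try exact: jac_MMM; try exact: jac_MMP; try exact: jac_HCP; try exact: jac_DHP.
all: rewrite /jac ?table ?HP ?PH ?table ?HP ?(leq_trans (leq_pred _)) //.
all: by rewrite ?table; scalars.
Qed.

Lemma jac_vec a b c : wf_letter a -> wf_letter b -> wf_letter c ->
  jac (vec a) (vec b) (vec c) = 0.
Proof.
move=> aN bN cN.
have cy x y z : jac x y z = 0 -> jac z x y = 0.
  by move=> <-; rewrite /jac -addrA addrC.
have sw x y z : jac x y z = 0 -> jac y x z = 0.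
  rewrite /jac (brC y z) (brC x y) (brC z x) !brN -!opprD => /eqP.
  by rewrite oppr_eq0 [X in X + _ == _]addrC => /eqP.
have [ab|/ltnW ab] := leqP (rank a) (rank b);
have [bc|/ltnW bc] := leqP (rank b) (rank c);
have [ac|/ltnW ac] := leqP (rank a) (rank c).
- by apply: jac_sorted; rewrite ?ab.
- by apply: jac_sorted; rewrite ?ab.
- by do 2!apply: (cy); apply: (sw); apply: jac_sorted; rewrite ?ac.
- by do 2!apply: (cy); apply: jac_sorted; rewrite ?ac.
- by apply: (sw); apply: jac_sorted; rewrite ?ab.
- by apply: (cy); apply: jac_sorted; rewrite ?bc.
- by apply: (cy); apply: (sw); apply: jac_sorted; rewrite ?bc.
- by apply: (cy); apply: (sw); apply: jac_sorted; rewrite ?bc.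
Qed.

End JacobiFromTable.

Section ConformalGalilei.
(* twol stands for 2l. *)
Variables (K : numFieldType) (twol d : nat).

(* GM p is M_(p.1, p.2), with p.1 < p.2;  GP (i, n) is P_i^(n). *)
Variant gen : Type :=
  | GD | GH | GC
  | GM of {p : 'I_d * 'I_d | (p.1 < p.2)%N}
  | GP of 'I_d * 'I_twol.+1.

Definition gen_code (a : gen) :
    'I_3 + {p : 'I_d * 'I_d | (p.1 < p.2)%N} + 'I_d * 'I_twol.+1 :=
  match a with
  | GD => inl (inl (inord 0))
  | GH => inl (inl (inord 1))
  | GC => inl (inl (inord 2))
  | GM p => inl (inr p)
  | GP q => inr q
  end.

Definition gen_decode
    (u : 'I_3 + {p : 'I_d * 'I_d | (p.1 < p.2)%N} + 'I_d * 'I_twol.+1) : gen :=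
  match u with
  | inl (inl k) => nth GD [:: GD; GH; GC] k
  | inl (inr p) => GM p
  | inr q => GP q
  end.

Lemma gen_codeK : cancel gen_code gen_decode.
Proof. by case=> //=; rewrite inordK. Qed.

HB.instance Definition _ := Finite.copy gen (can_type gen_codeK).

Definition cga : Type := {ffun gen -> K^o}.
HB.instance Definition _ := Vector.copy cga {ffun gen -> K^o}.

Lemma cga_addE (x y : cga) a : (x + y) a = x a + y a.
Proof. exact: ffunE. Qed.

Lemma cga_oppE (x : cga) a : (- x) a = - x a.
Proof. exact: ffunE. Qed.

Lemma cga_scaleE c (x : cga) a : (c *: x) a = c * x a.
Proof. exact: ffunE. Qed.

Definition ell : K := twol%:R / 2.

Definition basis (a : gen) : cga := [ffun b => (b == a)%:R].

Definition vD := basis GD.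
Definition vH := basis GH.
Definition vC := basis GC.

(* M_ij for arbitrary i, j: M_ji = - M_ij and M_ii = 0. *)
Definition vM (i j : 'I_d) : cga :=
  [ffun b => if b is GM p then (sval p == (i, j))%:R - (sval p == (j, i))%:R
             else 0].

(* P_i^(n) for arbitrary n; it vanishes when n > 2l. *)
Definition vP (i : 'I_d) (n : nat) : cga :=
  [ffun b => if b is GP q then ((q.1 == i) && (q.2 == n :> nat))%:R else 0].

Definition delta (i j : 'I_d) : K := (i == j)%:R.

(* One orientation of each bracket of basis elements, except for [M, M], which
   is given for all pairs.  At n = 0, [H, P_i^(n)] is zero as its factor n is. *)
Definition half_bracket (a b : gen) : cga :=
  match a, b with
  | GD, GH => 2 *: vH
  | GD, GC => - 2 *: vC
  | GC, GH => vD
  | GH, GP (i, n) => - n%:R *: vP i n.-1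
  | GD, GP (i, n) => (2 * (ell - n%:R)) *: vP i n
  | GC, GP (i, n) => (2 * ell - n%:R) *: vP i n.+1
  | GM p, GP (k, n) =>
      let: (i, j) := sval p in - delta i k *: vP j n + delta j k *: vP i n
  | _, _ => 0
  end.

Definition gen_bracket (a b : gen) : cga :=
  match a, b with
  | GM p, GM q =>
      let: (i, j) := sval p in
      let: (k, l) := sval q in
      - delta i k *: vM j l - delta j l *: vM i k
      + delta i l *: vM j k + delta j k *: vM i l
  | _, _ => half_bracket a b - half_bracket b a
  end.

Definition cga_lie (x y : cga) : cga :=
  \sum_a \sum_b (x a * y b) *: gen_bracket a b.

Lemma cga_lie_linear_l y : linear (cga_lie^~ y).
Proof.
move=> c x x'; rewrite /cga_lie scaler_sumr -big_split; apply: eq_bigr => a _ /=.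
rewrite scaler_sumr -big_split; apply: eq_bigr => b _ /=.
by rewrite !ffunE scalerA -scalerDl mulrDl mulrA.
Qed.

Lemma cga_lie_linear_r x : linear (cga_lie x).
Proof.
move=> c y y'; rewrite /cga_lie scaler_sumr -big_split; apply: eq_bigr => a _ /=.
rewrite scaler_sumr -big_split; apply: eq_bigr => b _ /=.
rewrite !ffunE scalerA -scalerDl mulrDr; congr (_ *: _); congr (_ + _).
exact: mulrCA.
Qed.

HB.instance Definition _ x :=
  GRing.isLinear.Build K cga cga _ (cga_lie x) (cga_lie_linear_r x).

Lemma cga_lieDr x y z : cga_lie x (y + z) = cga_lie x y + cga_lie x z.
Proof. exact: linearD. Qed.

Lemma cga_lieZr x c y : cga_lie x (c *: y) = c *: cga_lie x y.
Proof. exact: linearZ. Qed.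

Lemma cga_lieNr x y : cga_lie x (- y) = - cga_lie x y.
Proof. exact: linearN. Qed.

Lemma cga_lie0r x : cga_lie x 0 = 0.
Proof. exact: linear0. Qed.

Lemma cga_sum (x : cga) : x = \sum_a x a *: basis a.
Proof.
apply/ffunP => b; rewrite sum_ffunE (bigD1 b) //= big1 ?addr0.
  by rewrite !ffunE eqxx; exact/esym/mulr1.
by move=> a /negPf ab; rewrite !ffunE eq_sym ab; exact: mulr0.
Qed.

Lemma cga_lie_basis a b : cga_lie (basis a) (basis b) = gen_bracket a b.
Proof.
rewrite /cga_lie (bigD1 a) //= [X in _ + X]big1 ?addr0; last first.
  move=> a' /negPf aa; rewrite big1 // => b' _.
  by rewrite !ffunE aa mul0r scale0r.
rewrite (bigD1 b) //= big1 ?addr0; last first.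
  by move=> b' /negPf bb; rewrite !ffunE bb mulr0 scale0r.
by rewrite !ffunE !eqxx mul1r scale1r.
Qed.

Lemma deltaC i j : delta i j = delta j i.
Proof. by rewrite /delta eq_sym. Qed.

Lemma vM_antisym i j : vM i j = - vM j i.
Proof.
by apply/ffunP => -[|||p|q]; rewrite !ffunE ?opprB ?oppr0.
Qed.

Lemma vM_basis p : vM (sval p).1 (sval p).2 = basis (GM p).
Proof.
apply/ffunP => -[|||q|q]; rewrite !ffunE //= -surjective_pairing.
have -> : sval q == ((sval p).2, (sval p).1) = false.
  case: p q => [[i j] /= ij] [[k l] /= kl]; apply/negP => /eqP[kj li].
  by move: ij; rewrite -kj -li ltnNge (ltnW kl).
by rewrite subr0.
Qed.

Lemma vP_basis i (n : 'I_twol.+1) : vP i n = basis (GP (i, n)).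
Proof. by apply/ffunP => -[|||q|[k m]]; rewrite !ffunE. Qed.

Lemma vP_big i n : (twol < n)%N -> vP i n = 0.
Proof.
move=> n_big; apply/ffunP => -[|||q|[k m]]; rewrite !ffunE //=.
have [mn|] := eqVneq (m : nat) n; rewrite ?andbF //.
by move: n_big; rewrite -mn ltnNge -ltnS ltn_ord.
Qed.

Lemma gen_bracketC a b : gen_bracket a b = - gen_bracket b a.
Proof.
case: a b => [|||[[i j] ij]|q] [|||[[k l] kl]|q']; rewrite /gen_bracket ?opprB //=.
rewrite (vM_antisym l j) (vM_antisym k i) (vM_antisym l i) (vM_antisym k j).
rewrite (deltaC k i) (deltaC l j) (deltaC k j) (deltaC l i).
rewrite -!scaleNr !scalerN; apply/ffunP => b; rewrite !ffunE /GRing.scale /=; ring.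
Qed.

Lemma cga_lieC x y : cga_lie x y = - cga_lie y x.
Proof.
rewrite /cga_lie exchange_big -sumrN /=; apply: eq_bigr => a _.
rewrite -sumrN; apply: eq_bigr => b _.
by rewrite gen_bracketC scalerN mulrC.
Qed.

Lemma cga_lieNl x y : cga_lie (- x) y = - cga_lie x y.
Proof. by rewrite cga_lieC (cga_lieC x); congr (- _); exact: linearN. Qed.

Lemma cga_lie_alt x : cga_lie x x = 0.
Proof.
have /eqP := cga_lieC x x; rewrite -addr_eq0 -mulr2n -scaler_nat scaler_eq0.
by rewrite pnatr_eq0 => /eqP.
Qed.

(* Only the bracket of H and P_i^(n) needs n <= 2l: for larger n, vP i n is zero
   but vP i n.-1 may not be. *)
Lemma lieDH : cga_lie vD vH = 2 *: vH.
Proof. by rewrite cga_lie_basis /= subr0. Qed.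

Lemma lieDC : cga_lie vD vC = - 2 *: vC.
Proof. by rewrite cga_lie_basis /= subr0. Qed.

Lemma lieCH : cga_lie vC vH = vD.
Proof. by rewrite cga_lie_basis /= subr0. Qed.

Lemma vM_ltn (i j : 'I_d) (ij : (i < j)%N) :
  vM i j = basis (GM (exist (fun p : 'I_d * 'I_d => (p.1 < p.2)%N) (i, j) ij)).
Proof. by rewrite -vM_basis. Qed.

Lemma vM_ind (Q : 'I_d -> 'I_d -> cga -> Prop) :
  (forall i, Q i i 0) ->
  (forall i j x, Q i j x -> Q j i (- x)) ->
  (forall p, Q (sval p).1 (sval p).2 (basis (GM p))) ->
  forall i j, Q i j (vM i j).
Proof.
move=> Q0 QN QM i j; have [ij|ji|/val_inj <-] := ltngtP i j.
- by rewrite vM_ltn; exact: (QM (exist _ (i, j) ij)).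
- by rewrite vM_antisym; apply: QN; rewrite vM_ltn; exact: (QM (exist _ (j, i) ji)).
- suff -> : vM i i = 0 by [].
  by apply/ffunP => -[|||p|q]; rewrite !ffunE ?subrr.
Qed.

Lemma lieMM i j k l :
  cga_lie (vM i j) (vM k l) =
  - delta i k *: vM j l - delta j l *: vM i k
  + delta i l *: vM j k + delta j k *: vM i l.
Proof.
pose F i j k l :=   - delta i k *: vM j l - delta j l *: vM i k
  + delta i l *: vM j k + delta j k *: vM i l.
rewrite -/(F i j k l).
have F1 i' j' k' l' : F j' i' k' l' = - F i' j' k' l'.
  by rewrite /F; apply/ffunP => b; rewrite !ffunE /GRing.scale /=; ring.
have F2 i' j' k' l' : F i' j' l' k' = - F i' j' k' l'.
  by rewrite /F; apply/ffunP => b; rewrite !ffunE /GRing.scale /=; ring.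
have F0 (x : cga) : x = - x -> x = 0.
  move=> /eqP; rewrite -addr_eq0 -mulr2n -scaler_nat scaler_eq0.
  by rewrite pnatr_eq0 => /eqP.
pattern i, j, (vM i j); apply: vM_ind i j => [i|i j x IH|p].
- by rewrite cga_lieC linear0 oppr0; apply/esym/F0/F1.
- by rewrite F1 -IH cga_lieNl.
pattern k, l, (vM k l); apply: vM_ind k l => [k|k l x IH|q].
- by rewrite linear0; apply/esym/F0/F2.
- by rewrite F2 -IH linearN.
by rewrite cga_lie_basis /F /=; case: (sval p) (sval q) => ? ? [].
Qed.

Lemma lieHP i n : (n <= twol)%N -> cga_lie vH (vP i n) = - n%:R *: vP i n.-1.
Proof.
rewrite -ltnS => n_le; rewrite -[n]/(nat_of_ord (Ordinal n_le)) vP_basis.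
by rewrite cga_lie_basis /= subr0.
Qed.

Lemma lieDP i n : cga_lie vD (vP i n) = (2 * (ell - n%:R)) *: vP i n.
Proof.
have [n_le|n0] := ltnP n twol.+1; last by rewrite vP_big // linear0 scaler0.
rewrite -[n]/(nat_of_ord (Ordinal n_le)) vP_basis.
by rewrite cga_lie_basis /= subr0 -vP_basis.
Qed.

Lemma lieCP i n : cga_lie vC (vP i n) = (2 * ell - n%:R) *: vP i n.+1.
Proof.
have [n_le|n0] := ltnP n twol.+1.
  rewrite -[n]/(nat_of_ord (Ordinal n_le)) vP_basis.
  by rewrite cga_lie_basis /= subr0.
by rewrite !vP_big ?linear0 ?scaler0 // ltnW.
Qed.

Lemma lieMP i j k n :
  cga_lie (vM i j) (vP k n) = - delta i k *: vP j n + delta j k *: vP i n.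
Proof.
have [n_le|n0] := ltnP n twol.+1; last first.
  by rewrite !vP_big ?linear0 ?scaler0 ?addr0.
rewrite -[n]/(nat_of_ord (Ordinal n_le)) vP_basis.
pattern i, j, (vM i j); apply: vM_ind i j => [i|i j x IH|p].
- by rewrite cga_lieC linear0 oppr0 scaleNr addNr.
- by rewrite cga_lieNl IH opprD !scaleNr opprK addrC.
by rewrite cga_lie_basis /= subr0; case: (sval p).
Qed.

Lemma lieDM i j : cga_lie vD (vM i j) = 0.
Proof.
apply: (vM_ind (Q := fun _ _ x => cga_lie vD x = 0)) => [_|_ _ x IH|p].
- exact: linear0.
- by rewrite cga_lieNr IH oppr0.
- by rewrite cga_lie_basis /= subr0.
Qed.

Lemma lieHM i j : cga_lie vH (vM i j) = 0.
Proof.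
apply: (vM_ind (Q := fun _ _ x => cga_lie vH x = 0)) => [_|_ _ x IH|p].
- exact: linear0.
- by rewrite cga_lieNr IH oppr0.
- by rewrite cga_lie_basis /= subr0.
Qed.

Lemma lieCM i j : cga_lie vC (vM i j) = 0.
Proof.
apply: (vM_ind (Q := fun _ _ x => cga_lie vC x = 0)) => [_|_ _ x IH|p].
- exact: linear0.
- by rewrite cga_lieNr IH oppr0.
- by rewrite cga_lie_basis /= subr0.
Qed.

Lemma liePP i j m n : cga_lie (vP i m) (vP j n) = 0.
Proof.
have [m_le|m0] := ltnP m twol.+1; last by rewrite cga_lieC [vP i m]vP_big // cga_lie0r oppr0.
have [n_le|n0] := ltnP n twol.+1; last by rewrite [vP j n]vP_big // linear0.
rewrite -[m]/(nat_of_ord (Ordinal m_le)) -[n]/(nat_of_ord (Ordinal n_le)).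
by rewrite !vP_basis cga_lie_basis /= subr0.
Qed.

Lemma ell2 : 2 * ell = twol%:R.
Proof. by rewrite /ell mulrC divfK // pnatr_eq0. Qed.

Local Notation cga_jac := (jac cga_lie).

Lemma cga_jac_cycle x y z : cga_jac x y z = cga_jac y z x.
Proof. by rewrite /jac -addrA addrC. Qed.

Lemma cga_jac_linear y z : linear (fun x => cga_jac x y z).
Proof.
move=> c x x'; rewrite /jac.
have L := cga_lie_linear_l; have R := cga_lie_linear_r.
rewrite (R z c x x') (R y c) (L (cga_lie y z) c x x') (L y c x x') (R z c).
by rewrite !scalerDr [X in X + _ = _]addrACA [LHS]addrACA.
Qed.

Lemma cga_basis_ext (f : cga -> cga) :
  linear f -> (forall a, f (basis a) = 0) -> forall x, f x = 0.
Proof.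
move=> f_lin f0 x; pose F : {linear cga -> cga} :=
  HB.pack f (GRing.isLinear.Build K cga cga _ f f_lin).
rewrite -[f]/(F : cga -> cga) [x]cga_sum linear_sum big1 // => a _.
by rewrite linearZ [F _]f0; exact: scaler0.
Qed.

Let letter_of (a : gen) : letter 'I_d :=
  match a with
  | GD => LD _ | GH => LH _ | GC => LC _
  | GM p => LM (sval p).1 (sval p).2
  | GP q => LP q.1 q.2
  end.

Let letter_ofP a : wf_letter twol (letter_of a) /\
  vec vD vH vC vM vP (letter_of a) = basis a.
Proof.
case: a => [|||p|[i n]] //=; first by rewrite vM_basis.
by rewrite vP_basis -ltnS ltn_ord.
Qed.

Lemma cga_jac_basis a b c : cga_jac (basis a) (basis b) (basis c) = 0.
Proof.
have [aN <-] := letter_ofP a; have [bN <-] := letter_ofP b.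
have [cN <-] := letter_ofP c.
apply: (@jac_vec K twol 'I_d cga gen (fun t x => x t) cga_lie vD vH vC vM vP
  delta ell) => //.
- by move=> t x y; rewrite ffunE.
- by move=> t; rewrite ffunE.
- by move=> t x; rewrite ffunE.
- by move=> t e x; rewrite ffunE.
- by move=> x y xy; apply/ffunP.
- exact: cga_lieC.
- exact: cga_lieDr.
- exact: cga_lieNr.
- exact: cga_lieZr.
- exact: cga_lie0r.
- exact: deltaC.
- exact: vM_antisym.
- exact: ell2.
- exact: cga_lie_alt.
- exact: cga_lie_alt.
- exact: cga_lie_alt.
- exact: lieDH.
- exact: lieDC.
- exact: lieCH.
- exact: lieDM.
- exact: lieHM.
- exact: lieCM.
- exact: lieMM.
- exact: lieDP.
- exact: lieHP.
- exact: lieCP.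
- exact: lieMP.
- exact: liePP.
Qed.

Lemma cga_lie_jacobi x y z : cga_jac x y z = 0.
Proof.
apply: (cga_basis_ext (cga_jac_linear y z)) => a; rewrite cga_jac_cycle.
apply: (cga_basis_ext (cga_jac_linear z _)) => b; rewrite cga_jac_cycle.
apply: (cga_basis_ext (cga_jac_linear _ _)) => c; exact: cga_jac_basis.
Qed.

HB.instance Definition _ := Vector_isLieAlgebra.Build K cga
  cga_lie_linear_l cga_lie_linear_r cga_lie_alt cga_lie_jacobi.

(* The linear extension of a map given on the basis *)
Definition extend (f : gen -> cga) (x : cga) : cga := \sum_a x a *: f a.

Lemma extend_linear f : linear (extend f).
Proof.
move=> c x y; rewrite /extend scaler_sumr -big_split; apply: eq_bigr => a _ /=.
by rewrite !ffunE scalerA -scalerDl.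
Qed.
HB.instance Definition _ f :=
  GRing.isLinear.Build K cga cga _ (extend f) (extend_linear f).

Definition delta0 : 'End(cga) :=
  linfun (extend (fun a => if a is GP _ then basis a else 0)).

Lemma delta0_basis a : delta0 (basis a) = if a is GP _ then basis a else 0.
Proof.
rewrite lfunE /= /extend (bigD1 a) //= big1 ?addr0.
  by rewrite ffunE eqxx scale1r.
by move=> b /negPf ba; rewrite ffunE ba scale0r.
Qed.

End ConformalGalilei.

(* Main.v *)
(* By the eigenspaces of ad D, a derivation f can be corrected by an inner one
   so that f(D), then f(H), then f(C) vanish: f(D) ends up in the invariants of
   sl2 = <D, H, C>, which are so(d) = <M_ij>.  Such an f commutes with sl2, so it
   preserves so(d), and f(P_i^(0)) is a highest weight vector of weight 2l, i.e.
   sum_j a_ij P_j^(0), plus a multiple of H when 2l = 2; that multiple is killed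
   by [P, P] = 0.  As f(M_ij) acts on <P_k^(0)> by the commutator of a with M_ij,
   which must be antisymmetric, the symmetric part of a commutes with so(d), and
   this makes it scalar for every d.  Subtracting the inner derivation given by
   the antisymmetric part of a, and a multiple of delta_0, one gets f = 0 on all
   P_i^(n) (generated by the P_i^(0) under C), then on so(d), which acts
   faithfully on <P_k^(0)>. *)
Require Import Defs.
From mathcomp Require Import all_boot all_order all_algebra.
From mathcomp Require Import ring.
From mathcomp Require Import reals.
From mathcomp Require Import complex.

Set Implicit Arguments.
Unset Strict Implicit.
Unset Printing Implicit Defensive.

Import Order.TTheory GRing.Theory Num.Theory.
Local Open Scope ring_scope.
Local Open Scope complex_scope.

Section CgaDerivations.
Variables (K : numFieldType) (twol d : nat).

Local Notation g := (cga K twol d).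
Local Notation gen := (gen twol d).
Local Notation "{[ x , y ]}" := (@cga_lie K twol d x y) (x, y at level 99).
Local Notation e := (@basis K twol d).
Local Notation D := (vD K twol d).
Local Notation H := (vH K twol d).
Local Notation C := (vC K twol d).
Local Notation M := (@vM K twol d).
Local Notation P := (@vP K twol d).
Local Notation delta0 := (delta0 K twol d).
Local Notation GD := (GD twol d).
Local Notation GH := (GH twol d).
Local Notation GC := (GC twol d).
Implicit Types (x y : g) (f : 'End(g)) (i j k l : 'I_d) (n m : nat).

(** * Coordinates, and linear forms determined by their values on the basis *)

(* Extended by zero to n > 2l, so that the bracket formulas hold for all n. *)
Definition cP i n x : K := oapp (fun m : 'I_twol.+1 => x (GP (i, m))) 0 (insub n).

Lemma cP_ord i (n : 'I_twol.+1) x : cP i n x = x (GP (i, n)).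
Proof. by rewrite /cP valK. Qed.

Lemma cP_big i n x : (twol < n)%N -> cP i n x = 0.
Proof. by move=> n_big; rewrite /cP insubF // ltnNge n_big. Qed.

Lemma cPP i n x : cP i n x =
  if ltnP n twol.+1 is LtnNotGeq ltn then x (GP (i, Ordinal ltn)) else 0.
Proof.
by case: ltnP => n_le; [rewrite -cP_ord | rewrite cP_big].
Qed.

Lemma cPZD i n c x y : cP i n (c *: x + y) = c * cP i n x + cP i n y.
Proof.
by rewrite !cPP; case: ltnP => // *; rewrite ?cga_addE ?cga_scaleE ?mulr0 ?addr0.
Qed.

Lemma cP0 i n : cP i n 0 = 0.
Proof. by rewrite !cPP; case: ltnP => // *; rewrite ffunE. Qed.

Lemma cPZ i n c x : cP i n (c *: x) = c * cP i n x.
Proof. by rewrite -[c *: x]addr0 cPZD cP0 addr0. Qed.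

Lemma cPD i n x y : cP i n (x + y) = cP i n x + cP i n y.
Proof. by rewrite -[x]scale1r cPZD scale1r mul1r. Qed.

Lemma cPN i n x : cP i n (- x) = - cP i n x.
Proof. by rewrite -scaleN1r cPZ mulN1r. Qed.

Lemma cP_vP i n j m : (n <= twol)%N -> cP i n (P j m) = ((i == j) && (n == m))%:R.
Proof. by rewrite -ltnS cPP; case: ltnP => // n_lt _; rewrite ffunE. Qed.

Lemma cP_vM i n j k : cP i n (M j k) = 0.
Proof. by rewrite cPP; case: ltnP => // *; rewrite ffunE. Qed.

Lemma cP_basis i n a : cP i n (e a) =
  if a is GP q then ((i == q.1) && (n == q.2 :> nat))%:R else 0.
Proof.
rewrite cPP; case: ltnP => [n_lt|n_ge].
  by rewrite ffunE; case: a.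
case: a => // -[j m] /=; have [nm|] := eqVneq n m; last by rewrite andbF.
by move: n_ge; rewrite nm ltnNge -ltnS ltn_ord.
Qed.

Lemma basisE a b : e a b =
  match a, b with
  | Defs.GD, Defs.GD | Defs.GH, Defs.GH | Defs.GC, Defs.GC => 1
  | GM p, GM q => (q == p)%:R
  | GP p, GP q => (q == p)%:R
  | _, _ => 0
  end.
Proof.
rewrite ffunE; have [->|ba] := eqVneq b a.
  by case: a => *; rewrite ?eqxx.
case: a b ba => [|||p|p] [|||q|q]; rewrite ?eqxx //.
  by have [->|] := eqVneq q p; rewrite ?eqxx.
by have [->|] := eqVneq q p; rewrite ?eqxx.
Qed.

Lemma cgaP x y : x GD = y GD -> x GH = y GH -> x GC = y GC ->
  (forall p, x (GM twol p) = y (GM twol p)) ->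
  (forall i n, cP i n x = cP i n y) -> x = y.
Proof.
move=> xyD xyH xyC xyM xyP; apply/ffunP => -[|||p|[i n]] //.
by rewrite -!cP_ord.
Qed.

Lemma linear_form_eq0 (F : g -> K) :
  (forall c x y, F (c *: x + y) = c * F x + F y) ->
  (forall a, F (e a) = 0) -> forall x, F x = 0.
Proof.
move=> L F0 x.
rewrite [x]cga_sum; elim/big_rec: _ => [|a u _ u0].
  by have := L (-1) 0 0; rewrite scaler0 addr0 mulN1r addNr.
by rewrite L F0 u0 mulr0 addr0.
Qed.

Lemma lieZDr x c y z : {[x, c *: y + z]} = c *: {[x, y]} + {[x, z]}.
Proof. exact: (@cga_lie_linear_r K twol d). Qed.

Lemma lieZDl x c y z : {[c *: y + z, x]} = c *: {[y, x]} + {[z, x]}.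
Proof. exact: (@cga_lie_linear_l K twol d). Qed.

Lemma lie_sumr (I : finType) (Q : pred I) x (F : I -> g) :
  {[x, \sum_(i | Q i) F i]} = \sum_(i | Q i) {[x, F i]}.
Proof. exact: linear_sum. Qed.

Local Ltac lin := move=> *; rewrite ?(lieZDr, lieZDl, cPZD, cga_addE, cga_scaleE); ring.

(** Linearity is asked of the difference [F - G] only, so that for explicit coordinate formulas it
    is a single ring identity. *)
Lemma linear_form_ext (F G : g -> K) :
  (forall c x y, F (c *: x + y) - G (c *: x + y) =
     c * (F x - G x) + (F y - G y)) ->
  (forall a, F (e a) = G (e a)) -> forall x, F x = G x.
Proof.
move=> L FG x; apply/eqP; rewrite -subr_eq0; apply/eqP.
by apply: (linear_form_eq0 (F := fun x => F x - G x)) => // a; rewrite FG subrr.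
Qed.

(** * The actions of D, H and C in coordinates *)

Definition weight (a : gen) : K :=
  match a with
  | Defs.GH => 2 | Defs.GC => -2 | GP q => 2 * (ell K twol - q.2%:R)
  | _ => 0
  end.

Lemma lieD_coord x a : {[D, x]} a = weight a * x a.
Proof.
move: x; apply: linear_form_ext; first by lin.
move=> b; have -> : {[D, e b]} = weight b *: e b.
  rewrite /vD cga_lie_basis /=; case: b => [|||p|[i n]] /=;
    rewrite ?subr0 ?subrr ?scale0r //.
  by rewrite vP_basis.
by rewrite cga_scaleE ffunE; case: eqVneq => [->|_] //; rewrite !mulr0.
Qed.

Lemma lieD_cP x i n : cP i n {[D, x]} = 2 * (ell K twol - n%:R) * cP i n x.
Proof.
rewrite !cPP; case: ltnP => [n_lt|n_ge]; last by rewrite mulr0.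
by rewrite lieD_coord.
Qed.

Lemma lieHE b : {[H, e b]} = match b with
  | Defs.GD => - 2 *: H | Defs.GC => - D | GP q => - q.2%:R *: P q.1 q.2.-1
  | _ => 0 end.
Proof.
rewrite /vH cga_lie_basis /=; case: b => [|||p|[i n]] //=.
all: by rewrite ?subrr ?sub0r ?subr0 ?oppr0 ?scaleNr.
Qed.

Lemma lieCE b : {[C, e b]} = match b with
  | Defs.GD => 2 *: C | Defs.GH => D
  | GP q => (2 * ell K twol - q.2%:R) *: P q.1 q.2.+1
  | _ => 0 end.
Proof.
rewrite /vC cga_lie_basis /=; case: b => [|||p|[i n]] //=.
all: by rewrite ?subrr ?sub0r ?subr0 ?oppr0 ?scaleNr ?opprK.
Qed.

Local Ltac lieH_on_basis :=
  case=> [|||?|?]; rewrite lieHE;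
  rewrite ?cga_scaleE ?cga_oppE /vD /vH /vC ?basisE ?ffunE /=; ring.

Lemma lieH_D x : {[H, x]} GD = - x GC.
Proof.
move: x; apply: linear_form_ext; first by lin.
by lieH_on_basis.
Qed.

Lemma lieH_H x : {[H, x]} GH = - 2 * x GD.
Proof.
move: x; apply: linear_form_ext; first by lin.
by lieH_on_basis.
Qed.

Lemma lieH_C x : {[H, x]} GC = 0.
Proof.
move: x; apply: linear_form_eq0; first by lin.
by lieH_on_basis.
Qed.

Lemma lieH_M x p : {[H, x]} (GM twol p) = 0.
Proof.
move: x; apply: linear_form_eq0; first by lin.
by lieH_on_basis.
Qed.

Lemma lieH_P x i n : cP i n {[H, x]} = - n.+1%:R * cP i n.+1 x.
Proof.
have [n_le|n_gt] := leqP n twol; last by rewrite !cP_big ?mulr0 // ltnW.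
move: x; apply: linear_form_ext; first by lin.
move=> b; rewrite lieHE cP_basis.
case: b => [|||q|[j [m mP]]];
  rewrite ?cPZ ?cPN /vD /vH ?cP_basis ?cP0 ?oppr0 ?mulr0 //=.
rewrite cP_vP //; case: m {mP} => [|m] /=; first by rewrite andbF oppr0 mul0r mulr0.
by rewrite eqSS; case: (n =P m) => [->|_] //; rewrite !andbF !mulr0.
Qed.

(** * The subalgebra so(d) as the centralizer of sl2 *)

Definition in_so x := [/\ x GD = 0, x GH = 0, x GC = 0 & forall i n, cP i n x = 0].

Lemma in_so0 x : in_so x -> (forall p, x (GM twol p) = 0) -> x = 0.
Proof.
case=> xD xH xC xP xM; apply: cgaP; rewrite ?xD ?xH ?xC ?ffunE // => *.
  by rewrite xM ffunE.
by rewrite xP cP0.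
Qed.

Lemma in_so_D x : in_so x -> {[D, x]} = 0.
Proof.
case=> xD xH xC xP; apply: cgaP => [|||p|i n];
  rewrite ?lieD_coord ?lieD_cP ?xP ?xD ?xH ?xC ?cP0 ?ffunE ?mulr0 //=.
by rewrite mul0r.
Qed.

Lemma in_so_H x : in_so x -> {[H, x]} = 0.
Proof.
case=> xD xH xC xP; apply: cgaP => [|||p|i n].
all: by rewrite ?(lieH_D, lieH_H, lieH_C, lieH_M, lieH_P) ?(xP, xD, xC)
  ?cP0 ?ffunE ?mulr0 ?oppr0.
Qed.

Lemma in_so_C x : in_so x -> {[C, x]} = 0.
Proof.
move=> xS; rewrite [x]cga_sum; rewrite lie_sumr big1 // => a _.
case: xS => xD xH xC xP; rewrite cga_lieZr lieCE; case: a => [|||p|[i n]];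
  rewrite ?xD ?xH ?xC ?scale0r ?scaler0 //.
by rewrite -cP_ord xP scale0r.
Qed.

Hypothesis twol_gt0 : (0 < twol)%N.

Let twoK : 2 != 0 :> K. Proof. by rewrite pnatr_eq0. Qed.
Let ell2' : 2 * ell K twol = twol%:R. Proof. exact: ell2. Qed.
Let twolK : twol%:R != 0 :> K. Proof. by rewrite pnatr_eq0 -lt0n. Qed.
Let SK n : n.+1%:R != 0 :> K. Proof. by rewrite pnatr_eq0. Qed.

(** Commuting with D leaves only weight 0, which excludes H, C and the P_i^(0), of weight 2l > 0.
    Commuting with H excludes D and every P_i^(n+1), the factors 2 and n+1 being invertible. *)
Lemma in_so_centralizer x : {[D, x]} = 0 -> {[H, x]} = 0 -> in_so x.
Proof.
move=> Dx Hx.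
have xP i n : cP i n.+1 x = 0.
  have /eqP := lieH_P x i n; rewrite Hx cP0 eq_sym mulf_eq0 oppr_eq0.
  by rewrite (negPf (SK n)) => /eqP.
have xP0 i : cP i 0 x = 0.
  have /eqP := lieD_cP x i 0; rewrite Dx cP0 subr0 ell2' eq_sym mulf_eq0.
  by rewrite (negPf twolK) => /eqP.
split.
- have /eqP := lieH_H x; rewrite Hx ffunE eq_sym mulf_eq0 oppr_eq0.
  by rewrite (negPf twoK) => /eqP.
- have /eqP := lieD_coord x GH; rewrite Dx ffunE eq_sym mulf_eq0.
  by rewrite (negPf twoK) => /eqP.
- have /eqP := lieD_coord x GC; rewrite Dx ffunE eq_sym mulf_eq0 oppr_eq0.
  by rewrite (negPf twoK) => /eqP.
- by move=> i [|n].
Qed.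

(** * The action of so(d) on the span of the P_k^(0) *)

Lemma lieM_cP x i j l n :
  cP l n {[M i j, x]} = (l == i)%:R * cP j n x - (l == j)%:R * cP i n x.
Proof.
have [n_le|n_gt] := leqP n twol; last by rewrite !cP_big // !mulr0 subr0.
move: x; apply: linear_form_ext; first by lin.
case=> [|||p|[k m]].
- rewrite ![e _]/(D) cga_lieC lieDM /vD !cP_basis oppr0 cP0; ring.
- rewrite ![e _]/(H) cga_lieC lieHM /vH !cP_basis oppr0 cP0; ring.
- rewrite ![e _]/(C) cga_lieC lieCM /vC !cP_basis oppr0 cP0; ring.
- rewrite -vM_basis lieMM !(cPD, cPZ, cPN, cP_vM); ring.
- rewrite -vP_basis lieMP !(cPD, cPZ) !cP_vP // /delta.
  rewrite -!mulnb !natrM; ring.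
Qed.

(* For x in so(d), the matrix of ad x on the span of the P_k^(0). *)
Definition rotation x k l : K := cP l 0 {[x, P k 0]}.

Lemma rotation_sym x k l : x GD = 0 -> rotation x k l = - rotation x l k.
Proof.
(* The D term, from [D, P_k^(0)] = 2l P_k^(0), makes the identity true for every x, hence linear in
   x and checkable on the basis. *)
move=> xD; suff : rotation x k l = 2 * twol%:R * (k == l)%:R * x GD - rotation x l k.
  by rewrite xD mulr0 add0r.
move: x {xD}; apply: linear_form_ext; first by rewrite /rotation; lin.
rewrite /rotation => -[|||p|[i n]].
- rewrite ![e _]/(D) !lieDP !cPZ !cP_vP // subr0 ell2' /vD basisE /= !andbT (eq_sym l).
  ring.
- rewrite ![e _]/(H) !lieHP // !oppr0 !scale0r !cP0 /vH basisE /=; ring.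
- rewrite ![e _]/(C) !lieCP // !cPZ !cP_vP // !andbF /vC basisE /=; ring.
- rewrite -vM_basis !lieMP // !(cPZ, cPD) !cP_vP // !andbT ffunE /= ?subr0.
  rewrite /delta (eq_sym l (sval p).1) (eq_sym l (sval p).2).
  rewrite (eq_sym k (sval p).1) (eq_sym k (sval p).2); ring.
- rewrite -vP_basis !liePP // !cP0 ffunE /=; ring.
Qed.

(** M_ij sends P_i^(0) to -P_j^(0), and no other basis element contributes to an entry above the
    diagonal. So the matrix determines the so(d) coordinates. *)
Lemma rotation_M x p : rotation x (sval p).1 (sval p).2 = - x (GM twol p).
Proof.
move: x; apply: linear_form_ext; first by rewrite /rotation; lin.
have ne : ((sval p).2 == (sval p).1) = false.
  by case: p => -[k l] /= kl; apply/negP => /eqP lk; move: kl; rewrite lk ltnn.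
rewrite /rotation => -[|||q|[i n]].
- rewrite ![e _]/(D) !lieDP !cPZ !cP_vP // ne /vD basisE /=; ring.
- rewrite ![e _]/(H) !lieHP // !oppr0 !scale0r !cP0 /vH basisE /=; ring.
- rewrite ![e _]/(C) !lieCP // !cPZ !cP_vP // !andbF /vC basisE /=; ring.
- rewrite -vM_basis !lieMP // !(cPZ, cPD) !cP_vP // !andbT /=.
  have -> : M (sval q).1 (sval q).2 (GM twol p) = (p == q)%:R.
    by rewrite vM_basis ffunE.
  have -> : (p == q) = ((sval p).1 == (sval q).1) && ((sval p).2 == (sval q).2).
    by rewrite -val_eqE -xpair_eqE -!surjective_pairing.
  rewrite /delta.
  (* Both pairs are increasing, so [q] cannot be [p] transposed. *)
  have -> : ((sval q).2 == (sval p).1)%:R * ((sval p).2 == (sval q).1)%:R = 0 :> K.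
    rewrite -natrM mulnb; case: andP => // -[/eqP qp /eqP pq].
    have pp : ((sval p).1 < (sval p).2)%N := valP p.
    have : ((sval q).1 < (sval q).2)%N := valP q.
    by rewrite -pq qp ltnNge (ltnW pp).
  by rewrite addr0 mulNr -natrM mulnb (eq_sym (sval q).1).
- rewrite -vP_basis !liePP // !cP0 ffunE /=; ring.
Qed.

Lemma in_so_faithful x : in_so x -> (forall k, {[x, P k 0]} = 0) -> x = 0.
Proof.
move=> xS x0; apply: in_so0 => // p.
by apply/eqP; rewrite -oppr_eq0 -rotation_M /rotation x0 cP0.
Qed.

(** * Derivations vanishing on sl2 *)

Section Derivation.
Variable f : 'End(g).
Hypothesis fD : derivation f.

Lemma derE x y : f {[x, y]} = {[f x, y]} + {[x, f y]}.
Proof. exact: fD. Qed.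

Hypothesis fsD : f D = 0.
Hypothesis fsH : f H = 0.
Hypothesis fsC : f C = 0.

(** Such an f commutes with ad D and ad H, both of which kill M_ij. *)
Lemma der_sl2_so i j : in_so (f (M i j)).
Proof.
apply: in_so_centralizer.
  have := derE D (M i j); rewrite fsD (cga_lieC 0) cga_lie0r oppr0 add0r => <-.
  by rewrite lieDM linear0.
have := derE H (M i j); rewrite fsH (cga_lieC 0) cga_lie0r oppr0 add0r => <-.
by rewrite lieHM linear0.
Qed.

Lemma der_sl2_P0 i : f (P i 0) = \sum_j cP j 0 (f (P i 0)) *: P j 0.
Proof.
have L x y : f x = 0 -> {[x, f y]} = f {[x, y]}.
  by move=> fx; rewrite derE fx (cga_lieC 0) cga_lie0r oppr0 add0r.
(* f commutes with D and H, so f P_i^(0) has weight 2l and is killed by H. *)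
set y := f (P i 0); pose q := \sum_j cP j 0 y *: P j 0.
have Dy : {[D, y]} = twol%:R *: y by rewrite L // lieDP linearZ /= subr0 ell2'.
have Hy : {[H, y]} = 0 by rewrite L // lieHP // oppr0 scale0r linear0.
have qP j n : cP j n q = (n == 0)%:R * cP j n y.
  rewrite /q (bigD1 j) //= cPD cPZ.
  have -> : cP j n (\sum_(k | k != j) cP k 0 y *: P k 0) = 0.
    elim/big_rec: _ => [|k u /negPf kj u0]; first exact: cP0.
    rewrite cPD cPZ u0 addr0; have [n_le|n_gt] := leqP n twol.
      by rewrite cP_vP // eq_sym kj mulr0.
    by rewrite (cP_big _ _ n_gt) mulr0.
  rewrite addr0; have [n_le|n_gt] := leqP n twol.
    by rewrite cP_vP // eqxx mulrC; case: n n_le => //= n _; rewrite !mul0r.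
  by rewrite !(cP_big _ _ n_gt) !mulr0.
have q0 a : (if a is GP _ then false else true) -> q a = 0.
  move=> aP; rewrite /q sum_ffunE big1 // => j _; rewrite cga_scaleE ffunE.
  by case: a aP => //= *; rewrite mulr0.
(* The H coordinate is kept for every l: its weight 2 agrees with 2l when l = 1, so weights alone do
   not exclude it. *)
have yE : y = y GH *: H + q.
  have yPS j n : cP j n.+1 y = 0.
    have /eqP := lieH_P y j n; rewrite Hy cP0 eq_sym mulf_eq0 oppr_eq0.
    by rewrite (negPf (SK n)) => /eqP.
  apply: cgaP => [|||p|j n];
    rewrite ?cga_addE ?cga_scaleE ?q0 /vH ?basisE /= ?addr0 ?mulr0 ?mulr1 //.
  - have /eqP := lieH_H y; rewrite Hy ffunE eq_sym mulf_eq0 oppr_eq0.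
    by rewrite (negPf twoK) => /eqP.
  - by have /eqP := lieH_D y; rewrite Hy ffunE eq_sym oppr_eq0 => /eqP.
  - have /eqP := lieD_coord y (GM twol p); rewrite Dy cga_scaleE mul0r mulf_eq0.
    by rewrite (negPf twolK) => /eqP.
  - rewrite cPD cPZ /vH cP_basis mulr0 add0r qP.
    case: n => [|n]; first by rewrite mul1r.
    by rewrite yPS mulr0.
have qq j n : {[q, P j n]} = 0.
  rewrite cga_lieC /q lie_sumr big1 ?oppr0 // => k _.
  by rewrite cga_lieZr liePP scaler0.
have Cq : {[P i 0, {[C, q]}]} = 0.
  rewrite /q [X in {[_, X]}]lie_sumr lie_sumr big1 // => k _.
  by rewrite !cga_lieZr lieCP cga_lieZr liePP !scaler0.
(* [P_i^(0), [C, P_i^(0)]] = 0; the image under f is -4 l b P_i^(0). *)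
have b0 : y GH = 0.
  have : {[y, {[C, P i 0]}]} + {[P i 0, {[C, y]}]} = 0.
    by rewrite [{[C, y]}]L // -derE lieCP subr0 cga_lieZr liePP scaler0 linear0.
  set b := y GH in yE *; rewrite {}yE lieZDr cga_lieDr Cq addr0 cga_lieZr lieCH.
  rewrite lieZDl lieCP !cga_lieZr qq scaler0 addr0 lieHP // subr0.
  rewrite (cga_lieC (P i 0) D) lieDP subr0 ell2'.
  move/(congr1 (cP i 0)); rewrite cP0 !(cPD, cPZ, cPN) cP_vP // !eqxx /=.
  have -> u v : u * (v * (-1%:R * 1)) + u * - (v * 1) = - (2 * v) * u :> K by ring.
  by move/eqP; rewrite mulf_eq0 oppr_eq0 mulf_eq0 (negPf twoK) (negPf twolK) => /eqP.
by rewrite {1}yE b0 scale0r add0r.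
Qed.

Lemma der_sl2_eq0 : (forall i, f (P i 0) = 0) -> f = 0.
Proof.
move=> fP0.
have fP i n : f (P i n) = 0.
  elim: n => [//|n IH].
  (* Below 2l the factor 2l - n in [C, P_i^(n)] is invertible; from 2l on, P_i^(n+1) is zero. *)
  have [n_lt|n_ge] := ltnP n twol; last by rewrite vP_big ?linear0.
  have := derE C (P i n); rewrite fsC IH cga_lie0r (cga_lieC 0) cga_lie0r oppr0 add0r.
  rewrite lieCP linearZ /= ell2' => /eqP; rewrite scaler_eq0 -natrB 1?ltnW // pnatr_eq0.
  by rewrite subn_eq0 leqNgt n_lt /= => /eqP.
have fM i j : f (M i j) = 0.
  apply: in_so_faithful => [|k]; first exact: der_sl2_so.
  have := derE (M i j) (P k 0); rewrite fP cga_lie0r addr0 => <-.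
  by rewrite lieMP linearD !linearZ /= !fP !scaler0 addr0.
apply/lfunP => x; rewrite zero_lfunE [x]cga_sum linear_sum big1 // => a _.
rewrite linearZ /=; suff -> : f (e a) = 0 by rewrite scaler0.
case: a => [|||p|[i n]].
- exact: fsD.
- exact: fsH.
- exact: fsC.
- by rewrite -vM_basis fM.
- by rewrite -vP_basis fP.
Qed.

(** The matrix of f on the span of the P_k^(0), row k holding the coordinates of f(P_k^(0)). *)
Let a k l := cP l 0 (f (P k 0)).

(** Everything follows from f(M_ij) having an antisymmetric matrix. Only the indices i and j occur,
    so d = 2 is covered as well, where so(2) is abelian and its commutant is larger than the
    scalars. *)
Lemma der_sl2_skew i j : i != j -> a i j = - a j i /\ a i i = a j j.
Proof.
move=> ij; have ji : (j == i) = false by rewrite eq_sym (negPf ij).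
pose x := f (M i j).
(* Coordinates of [f(M_ij), P_k] = f([M_ij, P_k]) - [M_ij, f(P_k)], all at level 0. *)
have xE k l : rotation x k l = - (i == k)%:R * a j l + (j == k)%:R * a i l
    - ((l == i)%:R * a k j - (l == j)%:R * a k i).
  have /(congr1 (cP l 0)) := derE (M i j) (P k 0).
  rewrite lieMP linearD !linearZ /= !(cPD, cPZ) lieM_cP -!/(a _ _) => fE.
  by rewrite /rotation -/x; move: fE; rewrite /delta => ->; ring.
have [xD _ _ _] := der_sl2_so i j.
have rS k l : rotation x k l = - rotation x l k := rotation_sym k l xD.
have two_inj (u v : K) : 2 * u = 2 * v -> u = v by exact: mulfI.
(* The matrix of x is antisymmetric: compare its entries (i, i), then (i, j)
   and (j, i). *)
split; apply: two_inj.
  have := rS i i; rewrite !xE !eqxx ji (negPf ij) => /eqP.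
  rewrite -subr_eq0 => /eqP /= rii; apply/eqP; rewrite -subr_eq0; apply/eqP.
  by rewrite -[RHS]oppr0 -rii; ring.
have := rS i j; rewrite !xE !eqxx ji (negPf ij) => /eqP.
rewrite -subr_eq0 => /eqP /= rij; apply/eqP; rewrite -subr_eq0; apply/eqP.
by rewrite -[RHS]rij; ring.
Qed.

End Derivation.

(** * Inner derivations and [delta0] are derivations *)

Lemma lfun_basis_ext (V : vectType K) (h : 'Hom(g, V)) :
  (forall b, h (e b) = 0) -> h = 0.
Proof.
move=> h0; apply/lfunP => x; rewrite zero_lfunE [x]cga_sum linear_sum big1 // => b _.
by rewrite linearZ /= h0 scaler0.
Qed.

Lemma adj_Der x : adj x \in Der g.
Proof.
apply/DerP => y z; rewrite !adjE.
rewrite -[lie]/(@cga_lie K twol d) (cga_lieC {[x, y]}) (cga_lieC x z) cga_lieNr.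
apply/eqP; rewrite -opprD -addr_eq0 [X in _ + X]addrC addrA.
by rewrite [X in X == _]cga_lie_jacobi.
Qed.

Lemma delta0_P i n : delta0 (P i n) = P i n.
Proof.
have [n_le|n_gt] := ltnP n twol.+1; last by rewrite vP_big ?linear0.
by rewrite -[n]/(nat_of_ord (Ordinal n_le)) vP_basis delta0_basis.
Qed.

Lemma delta0_M i j : delta0 (M i j) = 0.
Proof.
apply: (@vM_ind K twol d (fun _ _ x => delta0 x = 0)) => [_|_ _ x IH|p].
- exact: linear0.
- by rewrite linearN /= IH oppr0.
- by rewrite delta0_basis.
Qed.

(** [delta0] is the degree operator of the grading with sl2 and so(d) in degree 0 and the P_i^(n) in
    degree 1; [P, P] = 0 makes the bracket respect it. The bilinear defect is evaluated on pairs of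
    basis vectors. *)
Lemma delta0_Der : delta0 \in Der g.
Proof.
rewrite memv_ker lfunE /=; apply/eqP/lfun_basis_ext => b; apply: lfun_basis_ext => c.
have dD : delta0 D = 0 by rewrite delta0_basis.
have dH : delta0 H = 0 by rewrite delta0_basis.
have dC : delta0 C = 0 by rewrite delta0_basis.
have dN x : delta0 (- x) = - delta0 x by exact: linearN.
have dZ r x : delta0 (r *: x) = r *: delta0 x by exact: linearZ.
have dlt0 : delta0 0 = 0 by exact: linear0.
have dA x y : delta0 (x + y) = delta0 x + delta0 y by exact: linearD.
have l0 x : {[0, x]} = 0 by rewrite cga_lieC cga_lie0r oppr0.
rewrite der_defectE -[lie]/(@cga_lie K twol d).
rewrite cga_lie_basis !delta0_basis.
case: b c => [|||[[i j] ij]|[i n]] [|||[[k l] kl]|[k m]] /=.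
all: rewrite ?(cga_lie0r, l0, cga_lie_basis) /=.
all: rewrite ?(dD, dH, dC, dN, dZ, dA, dlt0, delta0_P, delta0_M).
all: apply/ffunP => t.
all: rewrite !(cga_addE, cga_scaleE, cga_oppE) ?[(0 : g) t]ffunE; ring.
Qed.

(** * Making a derivation vanish on sl2 by an inner correction *)

(** Outside so(d), weight 0 leaves D and possibly some P_i^(n+1). Apply f to [D, H] = 2H: on
    coordinates of weight 2 the terms in f(H) cancel, so [H, f(D)] has none, which forces these
    coordinates of f(D) to vanish. *)
Lemma der_D_in_so f : derivation f -> (forall b, weight b != 0 -> f D b = 0) ->
  in_so (f D).
Proof.
move=> fD fw.
have E : 2 *: f H = - {[H, f D]} + {[D, f H]}.
  by rewrite -(cga_lieC (f D)) -derE // lieDH linearZ.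
have wP i n : 2 * (ell K twol - n%:R) != 0 -> cP i n (f D) = 0.
  have [n_lt|n_ge] := ltnP n twol.+1; last by rewrite cP_big.
  by move=> w; rewrite (cP_ord i (Ordinal n_lt)) fw.
have fP i n : cP i n (f D) = 0.
  case: n => [|n]; first by rewrite wP // subr0 ell2'.
  have [w|] := eqVneq (2 * (ell K twol - n.+1%:R)) 0; last exact: wP.
  have w2 : 2 * (ell K twol - n%:R) = 2.
    by apply/eqP; rewrite -subr_eq0 -[X in _ == X]w -natr1; apply/eqP; ring.
  have /eqP := congr1 (cP i n) E; rewrite cPD cPZ cPN lieD_cP w2 lieH_P -subr_eq0.
  rewrite opprD addrCA subrr addr0 opprK mulNr oppr_eq0 mulf_eq0 (negPf (SK n)).
  by move/eqP.
split=> //; try by rewrite fw //= ?oppr_eq0.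
have /eqP := congr1 (fun u : g => u GH) E.
rewrite cga_addE cga_scaleE cga_oppE lieD_coord lieH_H -subr_eq0.
rewrite opprD addrCA subrr addr0 opprK mulNr oppr_eq0 mulf_eq0 (negPf twoK).
by move/eqP.
Qed.

Lemma kill_D f : exists x, forall b, weight b != 0 -> (f - adj x) D b = 0.
Proof.
(* Since (f - ad x)(D) = f(D) + [D, x], this inverts ad D on the nonzero weights. On weight 0 the
   division gives 0, which is harmless there. *)
exists [ffun b => - f D b / weight b] => b wb.
rewrite add_lfunE opp_lfunE adjE -[lie]/(@cga_lie K twol d) cga_lieC opprK.
by rewrite cga_addE lieD_coord ffunE mulrCA mulfV // mulr1 subrr.
Qed.

Let neg2K m : -2 != m%:R :> K.
Proof. by rewrite eq_sym -addr_eq0 -natrD pnatr_eq0 addn2. Qed.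

Let eigen_eq0 (u v z : K) : u != v -> u * z = v * z -> z = 0.
Proof.
by rewrite -subr_eq0 => uv /eqP; rewrite -subr_eq0 -mulrBl mulf_eq0 (negPf uv) => /eqP.
Qed.

Lemma der_eigen_H f : derivation f -> in_so (f D) -> {[D, f H]} = 2 *: f H.
Proof.
move=> fD fS; rewrite -linearZ -lieDH [RHS]derE //.
by rewrite (cga_lieC (f D)) in_so_H // oppr0 add0r.
Qed.

Lemma der_eigen_C f : derivation f -> in_so (f D) -> {[D, f C]} = - 2 *: f C.
Proof.
move=> fD fS; rewrite -linearZ -lieDC [RHS]derE //.
by rewrite (cga_lieC (f D)) in_so_C // oppr0 add0r.
Qed.

(** f(H) has weight 2, so [H, x] = -f(H) is solvable with x of weight 0; as such an x commutes with
    D, f(D) is unchanged. *)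
Lemma kill_H f : derivation f -> in_so (f D) ->
  exists x, (f - adj x) D = f D /\ (f - adj x) H = 0.
Proof.
move=> fD fS; have E := der_eigen_H fD fS; set y := f H in E *.
have cE b : weight b * y b = 2 * y b.
  by rewrite -lieD_coord E cga_scaleE.
have PE i n : 2 * (ell K twol - n%:R) * cP i n y = 2 * cP i n y.
  by rewrite -lieD_cP E cPZ.
(* P_i^(2l) is not in the image of ad H, but its weight -2l differs from 2. *)
have yP i n : (twol <= n)%N -> cP i n y = 0.
  rewrite leq_eqVlt => /orP[/eqP <-|]; last exact: cP_big.
  apply: eigen_eq0 (PE i twol).
  rewrite mulrBr ell2' mulr2n mulrDl mul1r opprD addrA subrr sub0r eqr_oppLR.
  by rewrite eq_sym neg2K.
(* Inverts [H, D] = -2H and [H, P_i^(m)] = -m P_i^(m-1). At m = 0 the division by zero gives the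
   coordinate 0. *)
pose x : g := [ffun b => match b with
  | Defs.GD => y GH / 2 | GP (i, m) => cP i m.-1 y / m%:R | _ => 0 end].
have xP i n : cP i n.+1 x = cP i n y / n.+1%:R.
  have [n_lt|n_ge] := ltnP n twol; last by rewrite cP_big // yP // mul0r.
  by rewrite -ltnS in n_lt; rewrite (cP_ord i (Ordinal n_lt)) ffunE.
have xP0 i : cP i 0 x = 0 by rewrite (cP_ord i ord0) ffunE invr0 mulr0.
exists x; rewrite !add_lfunE !opp_lfunE !adjE -[lie]/(@cga_lie K twol d).
rewrite (cga_lieC x D) (cga_lieC x H) !opprK; split.
  suff -> : {[D, x]} = 0 by rewrite addr0.
  apply: cgaP => [|||p|i [|n]];
    rewrite ?lieD_coord ?lieD_cP ?cP0 ?ffunE ?mul0r ?mulr0 //.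
    by rewrite xP0 mulr0.
  have -> : 2 * (ell K twol - n.+1%:R) = 2 * (ell K twol - n%:R) - 2.
    by rewrite -natr1; ring.
  by rewrite xP mulrA mulrBl PE subrr mul0r.
have z b : 2 != weight b -> y b = 0 by move=> /eigen_eq0; apply; rewrite cE.
rewrite -/y; apply: cgaP => [|||p|i n]; rewrite ?cga_addE ?cPD.
- by rewrite z // lieH_D !ffunE oppr0 addr0.
- by rewrite lieH_H !ffunE mulNr mulrC divfK // subrr.
- by rewrite z ?lieH_C ?ffunE ?addr0 // eq_sym neg2K.
- by rewrite z // lieH_M ffunE addr0.
- by rewrite lieH_P xP mulNr mulrC divfK // subrr cP0.
Qed.

(** f(C) has weight -2, where ad H is injective: only C and some P_i^(n+1) can occur. Applying f to
    [C, H] = D gives [H, f(C)] = -f(D), which lies in so(d) and so has no D or P coordinates. *)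
Lemma der_C_eq0 f : derivation f -> in_so (f D) -> f H = 0 -> f C = 0.
Proof.
move=> fD fS fH; have E := der_eigen_C fD fS; set y := f C in E *.
have F : - {[H, y]} = f D.
  by rewrite -cga_lieC -[RHS](congr1 f (lieCH K twol d)) derE // fH cga_lie0r addr0.
have z b : -2 != weight b -> y b = 0.
  by move=> /eigen_eq0; apply; rewrite -lieD_coord E cga_scaleE.
have [fDD _ _ fDP] := fS.
apply: cgaP => [|||p|i [|n]]; rewrite ?cP0 ?[RHS]ffunE.
- by rewrite z // (neg2K 0).
- by rewrite z // (neg2K 2).
- by apply/eqP; rewrite -oppr_eq0 -lieH_D -oppr_eq0 -cga_oppE F fDD.
- by rewrite z // (neg2K 0).
- rewrite (cP_ord i ord0) z //= subr0 ell2'; exact: neg2K.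
- have /eqP := congr1 (cP i n) F; rewrite cPN lieH_P fDP mulNr opprK mulf_eq0.
  by rewrite (negPf (SK n)) => /eqP.
Qed.

Lemma sub_adj_derivation f x : derivation f -> derivation (f - adj x).
Proof. by move=> /DerP fD; apply/DerP; rewrite memvB ?adj_Der. Qed.

Lemma adjD x y : adj (x + y) = adj x + adj y.
Proof. exact: linearD. Qed.

Lemma kill_sl2 f : derivation f ->
  exists x, [/\ (f - adj x) D = 0, (f - adj x) H = 0 & (f - adj x) C = 0].
Proof.
move=> fD; have [x1 f1] := kill_D f.
have f1D := sub_adj_derivation x1 fD; have f1S := der_D_in_so f1D f1.
have [x2 [f2D f2H]] := kill_H f1D f1S; have f2der := sub_adj_derivation x2 f1D.
exists (x1 + x2); rewrite adjD opprD addrA.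
move: (f - adj x1 - adj x2) f2D f2H f2der => h hD hH hder.
have hC : h C = 0 by apply: der_C_eq0 => //; rewrite hD.
split; [|exact: hH|exact: hC].
(* Only now does f(D), so far merely in so(d), vanish: D = [C, H]. *)
by rewrite -(lieCH K twol d) derE // hC hH cga_lie0r (cga_lieC 0) cga_lie0r oppr0 addr0.
Qed.

(** * The decomposition and its directness *)

Hypothesis d_gt0 : (0 < d)%N.

Lemma der_sl2_decomposition (h : 'End(g)) : derivation h ->
  h D = 0 -> h H = 0 -> h C = 0 -> exists x c, h = adj x + c *: delta0.
Proof.
move=> hD h1D h1H h1C.
pose a k l := cP l 0 (h (P k 0)); pose i0 := Ordinal d_gt0.
(* The sign is that of [rotation_M]: the matrix of ad x then agrees with [a] above the diagonal, and
   below it by antisymmetry. *)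
pose x : g := [ffun b => if b is GM p then - a (sval p).1 (sval p).2 else 0].
have xS : in_so x.
  by split=> [|||i n]; rewrite ?ffunE // cPP; case: ltnP => // *; rewrite ffunE.
have [xD _ _ _] := xS.
have aS i j : i != j -> a i j = - a j i /\ a i i = a j j.
  exact: der_sl2_skew.
have rE k l : (k < l)%N -> rotation x k l = a k l.
  move=> kl.
  have := rotation_M x (exist (fun p : 'I_d * 'I_d => (p.1 < p.2)%N) (k, l) kl).
  by move=> /= ->; rewrite ffunE opprK.
have r0 k : rotation x k k = 0.
  have /eqP := rotation_sym k k xD; rewrite -addr_eq0 -mulr2n -mulr_natl mulf_eq0.
  by rewrite (negPf twoK) => /eqP.
have h2D : derivation (h - adj x - a i0 i0 *: delta0).
  apply/DerP; rewrite memvB ?memvZ ?delta0_Der //.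
  by apply/DerP; exact: sub_adj_derivation.
exists x, (a i0 i0); apply/eqP; rewrite -subr_eq0 opprD addrA.
have hE u : (h - adj x - a i0 i0 *: delta0) u = h u - {[x, u]} - a i0 i0 *: delta0 u.
  by rewrite !add_lfunE !opp_lfunE scale_lfunE adjE -[lie]/(@cga_lie K twol d).
(* Elements of so(d) commute with sl2 and [delta0] vanishes on it, so the corrected derivation still
   kills sl2. *)
have kill u : h u = 0 -> {[u, x]} = 0 -> delta0 u = 0 ->
  (h - adj x - a i0 i0 *: delta0) u = 0.
  by move=> hu ux du; rewrite hE hu cga_lieC ux du oppr0 scaler0 !subr0.
have h2sD := kill _ h1D (in_so_D xS) (delta0_basis K GD).
have h2sH := kill _ h1H (in_so_H xS) (delta0_basis K GH).
have h2sC := kill _ h1C (in_so_C xS) (delta0_basis K GC).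
apply/eqP/der_sl2_eq0 => // k; rewrite der_sl2_P0 //; apply: big1 => l _.
suff -> : cP l 0 ((h - adj x - a i0 i0 *: delta0) (P k 0)) = 0 by rewrite scale0r.
rewrite hE !cPD !cPN cPZ delta0_P cP_vP // andbT -/(rotation x k l) -/(a k l).
have [kl|lk|/val_inj kl] := ltngtP k l.
- by rewrite rE // subrr -(inj_eq val_inj) gtn_eqF // mulr0 subr0.
- have [|aN _] := aS k l; first by rewrite -(inj_eq val_inj) gtn_eqF.
  by rewrite rotation_sym // rE // aN subrr -(inj_eq val_inj) ltn_eqF // mulr0 subr0.
rewrite -kl r0 eqxx mulr1 subr0.
have [->|ki] := eqVneq k i0; first by rewrite subrr.
by have [_ ->] := aS _ _ ki; rewrite subrr.
Qed.

Lemma der_decomposition f : derivation f -> exists x c, f = adj x + c *: delta0.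
Proof.
move=> fD; have [x1 [h1D h1H h1C]] := kill_sl2 fD.
have [x [c E]] := der_sl2_decomposition (sub_adj_derivation x1 fD) h1D h1H h1C.
by exists (x1 + x), c; rewrite adjD -addrA -E addrC subrK.
Qed.

(** [delta0] kills D and H, so x is in so(d) and its matrix on the P_k^(0) is antisymmetric. That
    matrix is also c times the identity, so a diagonal entry gives c = 0. *)
Lemma adj_delta0_eq0 x c : adj x = c *: delta0 -> c = 0.
Proof.
move=> E; have xE u : {[x, u]} = c *: delta0 u by rewrite -scale_lfunE -E adjE.
have xS : in_so x.
  apply: in_so_centralizer; rewrite cga_lieC xE delta0_basis scaler0 oppr0 //.
have [xD _ _ _] := xS; pose i0 := Ordinal d_gt0.
have /eqP := rotation_sym i0 i0 xD; rewrite -addr_eq0 -mulr2n -mulr_natl mulf_eq0.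
rewrite (negPf twoK) /rotation xE delta0_P cPZ cP_vP // eqxx mulr1.
by move/eqP.
Qed.

Theorem Der_cga : Der g = (Inn g + <[delta0]>)%VS /\ directv (Inn g + <[delta0]>).
Proof.
split.
  apply/vspaceP => f; apply/idP/idP => [/DerP fD|
    /memv_addP[_ /InnP[x ->] [_ /vlineP[c ->] ->]]].
    have [x [c ->]] := der_decomposition fD.
    by rewrite memv_add ?memvZ ?memv_line //; apply/InnP; exists x.
  by rewrite memvD ?adj_Der ?memvZ ?delta0_Der.
apply/directv_addP/eqP; rewrite -subv0; apply/subvP => f.
rewrite memv_cap memv0 => /andP[/InnP[x ->] /vlineP[c E]].
by rewrite E (adj_delta0_eq0 E) scale0r.
Qed.

End CgaDerivations.

Theorem theorem3p2 (R : realType) (twol d : nat) (twol_gt0 : (0 < twol)%N)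
    (d_gt0 : (0 < d)%N) :
  let g := cga R[i] twol d in
  Der g = (Inn g + <[delta0 R[i] twol d]>)%VS /\
  directv (Inn g + <[delta0 R[i] twol d]>).
Proof. exact: Der_cga. Qed.
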